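(* Let $t\in[0,T_1]$, $x\in\mathbb{R}^+$ and $d>0$. The forward price $g(t,x,d)=\frac1d\int_0^dX_t(x+u)\,du$ can be expressed as $$g(t,x,d)=\langle X_t,h_{x,d}\rangle_w,$$ where $$h_{x,d}(y)=\begin{cases}1+\int_0^y\frac{1}{w(s)}\,ds, & 0\le y\le x,\\[2pt] 1+\int_0^x\frac{1}{w(s)}\,ds+\int_0^{y-x}\frac{d-s}{d\,w(s+x)}\,ds, & x<y\le x+d,\\[2pt] 1+\int_0^x\frac{1}{w(s)}\,ds+\int_0^{d}\frac{d-s}{d\,w(s+x)}\,ds, & y>x+d.\end{cases}$$
   Context: $\mathbb{R}^+=\mathbb{R}_+=[0,\infty)$. Let $w:\mathbb{R}_+\to[1,\infty)$ be measurable and increasing with $w(0)=1$ and $\int_0^\infty w^{-1}(x)\,dx<\infty$. The Filipović space $H_w$ is the Hilbert space of $h\in L^1_{\mathrm{loc}}(\mathbb{R}_+)$ having a weak derivative $h'\in L^1_{\mathrm{loc}}(\mathbb{R}_+)$ with $\int_0^\infty|h'(x)|^2w(x)\,dx<\infty$, each identified with its absolutely continuous version, with inner product $\langle f,g\rangle_w=f(0)g(0)+\int_0^\infty f'(x)g'(x)w(x)\,dx$. $X=\{X_t\}_{t\ge0}$ is the $H_w$-valued process given by the mild solution $$X_t=\mathcal{S}_tx_0+\int_0^t\mathcal{S}_{t-s}(Z_s\otimes Y_s)\,dB_s,\qquad Y_t=\mathcal{U}_ty_0+\int_0^t\mathcal{U}_{t-s}\eta\,dW_s,$$ where $x_0,y_0\in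 H_w$, $\mathcal{S}_th=h(\cdot+t)$ is the left-shift semigroup on $H_w$, $\{\mathcal{U}_t\}$ is a $C_0$-semigroup on $H_w$, $\eta$ is a bounded linear operator on $H_w$, $B,W$ are independent $H_w$-valued Wiener processes with covariance operators $Q_B,Q_W$, $Z$ is an adapted $H_w$-valued process with $\|Z_t\|_w=1$ for all $t$, and $a\otimes b=\langle a,\cdot\rangle_w\,b$. The forward price is $f(t,x)=X_t(x)$, and the forward price with time $x$ to the start of delivery and delivery period of length $d$ is $g(t,x,d)=\frac1d\int_0^df(t,x+u)\,du$; $T_1$ denotes the start of the delivery period. *)

(* Defs.v *)
From Stdlib Require List.
From HB Require Import structures.
From mathcomp Require Import all_boot all_order all_algebra.
From mathcomp Require Import all_classical all_reals all_analysis.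
Set Implicit Arguments.
Unset Strict Implicit.
Unset Printing Implicit Defensive.
Import Order.TTheory GRing.Theory Num.Theory.
Import numFieldNormedType.Exports.
Local Open Scope classical_set_scope.
Local Open Scope ring_scope.

(* Elements of H_w are represented by functions R -> R of which only the
   restriction to [0, +oo[ is relevant: every notion below depends only on that
   restriction, and equality in H_w is [eqRp]. *)
Section filipovic_space.
Variable R : realType.
Implicit Types (w f g h phi : R -> R).
Local Notation mu := (@lebesgue_measure R).

Definition Rp : set R := `[0, +oo[.

Definition eqRp f g : Prop := forall x : R, 0 <= x -> f x = g x.

(* "increasing" is read in the wide sense *)
Definition weight w : Prop :=
  [/\ measurable_fun Rp w,
      (forall x : R, 0 <= x -> 1 <= w x),
      (forall x y : R, 0 <= x -> x <= y -> w x <= w y),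
      w 0 = 1 &
      (\int[mu]_(x in Rp) ((w x)^-1)%:E < +oo)%E].

Definition L1loc f : Prop :=
  forall b, mu.-integrable `[0, b] (EFin \o f).

(* C^oo functions with compact support in ]0, +oo[ *)
Definition test_fun phi : Prop :=
  (forall n x, derivable (derive1n n phi) x 1) /\
  (exists a b, 0 < a /\ forall x, ~~ (a <= x <= b) -> phi x = 0).

Definition weak_deriv f g : Prop :=
  forall phi, test_fun phi ->
    \int[mu]_(x in Rp) (f x * derive1 phi x) =
    - \int[mu]_(x in Rp) (g x * phi x).

(* absolute continuity on every [0, L] *)
Definition loc_abs_cont f : Prop :=
  forall L eps : R, 0 < eps -> exists2 delta : R, 0 < delta &
    forall (n : nat) (a b : 'I_n -> R),
      (forall i, [/\ 0 <= a i, a i <= b i & b i <= L]) ->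
      (forall i j, i != j -> b i <= a j \/ b j <= a i) ->
      \sum_i (b i - a i) < delta -> \sum_i `|f (b i) - f (a i)| < eps.

(* [Hw w f]: f is the absolutely continuous version of an element of H_w *)
Definition Hw w f : Prop :=
  [/\ L1loc f, loc_abs_cont f &
      exists g, [/\ L1loc g, weak_deriv f g &
        (\int[mu]_(x in Rp) (g x ^+ 2 * w x)%:E < +oo)%E]].

(* a choice of weak derivative, which is unique up to null sets *)
Definition wderiv f : R -> R :=
  xget (fun=> 0) [set g | L1loc g /\ weak_deriv f g].

Definition inner w f g : R :=
  f 0 * g 0 + \int[mu]_(x in Rp) (wderiv f x * wderiv g x * w x).

Definition Hnorm w f : R := Num.sqrt (inner w f f).

Definition bounded_op w (T : (R -> R) -> R -> R) : Prop :=
  [/\ (forall f, Hw w f -> Hw w (T f)),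
      (forall (a : R) f g, Hw w f -> Hw w g ->
         eqRp (T (fun x => a * f x + g x)) (fun x => a * T f x + T g x)) &
      exists C : R, forall f, Hw w f -> Hnorm w (T f) <= C * Hnorm w f].

Definition C0_semigroup w (U : R -> (R -> R) -> R -> R) : Prop :=
  [/\ (forall t : R, 0 <= t -> bounded_op w (U t)),
      (forall f, Hw w f -> eqRp (U 0 f) f),
      (forall (s t : R) f, 0 <= s -> 0 <= t -> Hw w f ->
         eqRp (U (s + t) f) (U s (U t f))) &
      (forall f, Hw w f -> Hnorm w (U t f \- f) @[t --> 0^'+] --> (0 : R))].

Definition left_shift (t : R) f : R -> R := fun x => f (x + t).

Definition tensor w (a b : R -> R) : (R -> R) -> R -> R :=
  fun f x => inner w a f * b x.

Definition orthonormal_basis w (e : nat -> R -> R) : Prop :=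
  [/\ (forall k, Hw w (e k)),
      (forall j k, inner w (e j) (e k) = (j == k)%:R) &
      (forall f, Hw w f -> (forall k, inner w f (e k) = 0) ->
         eqRp f (fun=> 0))].

(* symmetric nonnegative trace-class operators *)
Definition covariance_op w (Q : (R -> R) -> R -> R) : Prop :=
  [/\ bounded_op w Q,
      (forall f g, Hw w f -> Hw w g -> inner w (Q f) g = inner w f (Q g)),
      (forall f, Hw w f -> 0 <= inner w (Q f) f) &
      exists2 e, orthonormal_basis w e &
        (\sum_(0 <= k <oo) (inner w (Q (e k)) (e k))%:E < +oo)%E].

Definition eigenbasis w (Q : (R -> R) -> R -> R)
    (e : nat -> R -> R) (lam : nat -> R) : Prop :=
  orthonormal_basis w e /\ forall k, eqRp (Q (e k)) (fun x => lam k * e k x).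

(* the squared Hilbert-Schmidt norm of T Q^(1/2), where Q has eigenbasis
   (e, lam) *)
Definition HS_sq w (e : nat -> R -> R) (lam : nat -> R)
    (T : (R -> R) -> R -> R) : \bar R :=
  (\sum_(0 <= k <oo) (lam k * Hnorm w (T (e k)) ^+ 2)%:E)%E.

End filipovic_space.

Section processes.
Context (R : realType) (disp : measure_display) (Omega : measurableType disp).
Variables (P : probability Omega R) (F : R -> set (set Omega)).
Local Notation mu := (@lebesgue_measure R).
Local Notation process := (R -> Omega -> R -> R).
Local Notation op := ((R -> R) -> R -> R).
Implicit Types (w : R -> R) (V B : process) (Q : op).

Definition filtration : Prop :=
  [/\ (forall t : R, 0 <= t -> sigma_algebra setT (F t)),
      (forall t : R, 0 <= t -> F t `<=` measurable) &
      (forall s t : R, 0 <= s -> s <= t -> F s `<=` F t)].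

(* By separability of H_w, its Borel sigma-algebra is generated by the maps
   <., h>_w. *)
Definition Hw_sigma w (I : set R) V : set (set Omega) :=
  <<s [set A | exists t h (C : set R), [/\ I t, Hw w h, measurable C &
               A = (fun om => inner w (V t om) h) @^-1` C]] >>.

Definition Hw_process w V : Prop :=
  (forall (t : R) om, 0 <= t -> Hw w (V t om)) /\ Hw_sigma w (@Rp R) V `<=` measurable.

Definition adapted w V : Prop :=
  forall t : R, 0 <= t -> Hw_sigma w [set t] V `<=` F t.

Definition independent (G1 G2 : set (set Omega)) : Prop :=
  forall A1 A2, G1 A1 -> G2 A2 -> P (A1 `&` A2) = (P A1 * P A2)%E.

(* N(0, v), a Dirac mass when v = 0; [normal_prob] takes the standard
   deviation and is only meaningful when it is nonzero *)
Definition centered_gaussian (v : R) (C : set R) : \bar R :=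
  if v == 0 then \d_(0 : R) C else normal_prob 0 (Num.sqrt v) C.

Definition wiener w Q B : Prop :=
  [/\ Hw_process w B,
      adapted w B,
      {ae P, forall om, eqRp (B 0 om) (fun=> 0) /\
        forall t : R, 0 <= t ->
          Hnorm w (B s om \- B t om) @[s --> within (@Rp R) (nbhs t)]
            --> (0 : R)},
      (forall s t : R, 0 <= s -> s <= t ->
         independent (Hw_sigma w [set t] (fun u om => B u om \- B s om)) (F s)) &
      (forall (s t : R) h (C : set R), 0 <= s -> s <= t -> Hw w h -> measurable C ->
         P ((fun om => inner w (B t om \- B s om) h) @^-1` C) =
         centered_gaussian ((t - s) * inner w (Q h) h) C)].

(* the elementary operator-valued process 1_{]el_lo, el_hi]}(s) 1_{el_ev} el_op *)
Record elementary := Elementary {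
  el_lo : R; el_hi : R; el_ev : set Omega; el_op : op }.

Definition elementary_wf w (j : elementary) : Prop :=
  [/\ 0 <= el_lo j, el_lo j <= el_hi j, F (el_lo j) (el_ev j) &
      bounded_op w (el_op j)].

Definition simple_val (Psi : seq elementary) (s : R) (om : Omega) : op :=
  fun f y => \sum_(j <- Psi)
    \1_(`]el_lo j, el_hi j]) s * \1_(el_ev j) om * el_op j f y.

Definition simple_int B (t : R) (Psi : seq elementary) (om : Omega) : R -> R :=
  fun y => \sum_(j <- Psi) \1_(el_ev j) om *
    el_op j (B (Num.min (el_hi j) t) om \- B (Num.min (el_lo j) t) om) y.

(* convergence to 0 in probability, stated without assuming that the V n are
   measurable *)
Definition cvg_in_prob0 (V : nat -> Omega -> \bar R) : Prop :=
  forall eps : R, 0 < eps -> exists A : nat -> set Omega,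
    [/\ (forall n, measurable (A n)),
        (forall n, [set om | (eps%:E <= V n om)%E] `<=` A n) &
        P (A n) @[n --> \oo] --> 0%E].

(* [is_stoch_int w Q B t Phi J]: J is (a version of) the Ito integral
   \int_0^t Phi_s dB_s, i.e. the limit in probability of the integrals of simple
   processes converging to Phi in L^2([0, t]; HS(Q^(1/2) H_w, H_w)), in
   probability *)
Definition is_stoch_int w Q B (t : R) (Phi : R -> Omega -> op)
    (J : Omega -> R -> R) : Prop :=
  [/\ (forall om, Hw w (J om)),
      (forall (s : R) om, 0 <= s <= t -> forall f, Hw w f -> Hw w (Phi s om f)),
      (forall f h, Hw w f -> Hw w h ->
         measurable_fun (`[0, t] `*` [set: Omega])
           (fun z : R * Omega => inner w (Phi z.1 z.2 f) h)) &
      exists e lam (Psi : nat -> seq elementary),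
        [/\ eigenbasis w Q e lam,
            (forall n j, List.In j (Psi n) -> elementary_wf w j),
            cvg_in_prob0 (fun n om => (\int[mu]_(s in `[0%R, t])
              HS_sq w e lam
                (fun f => simple_val (Psi n) s om f \- Phi s om f)%R)%E) &
            cvg_in_prob0 (fun n om =>
              (Hnorm w (simple_int B t (Psi n) om \- J om))%:E)]].

(* V_t = S_t v0 + \int_0^t S_(t-s) Phi_s dB_s, almost surely for every t *)
Definition mild_solution w Q B (S : R -> op) (v0 : R -> R)
    (Phi : R -> Omega -> op) V : Prop :=
  forall t : R, 0 <= t -> exists2 J,
    is_stoch_int w Q B t (fun s om f => S (t - s) (Phi s om f)) J &
    {ae P, forall om, eqRp (V t om) (fun x => S t v0 x + J om x)}.

End processes.

Section forward_prices.
Context (R : realType) (Omega : Type).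
Local Notation mu := (@lebesgue_measure R).

Definition forward_price (X : R -> Omega -> R -> R) (t x : R) (om : Omega) : R :=
  X t om x.

(* the price over the delivery period of length d starting in time x *)
Definition delivery_price (X : R -> Omega -> R -> R) (t x d : R) (om : Omega) : R :=
  d^-1 * \int[mu]_(u in `[0, d]) forward_price X t (x + u) om.

Definition delivery_fun (w : R -> R) (x d y : R) : R :=
  if y <= x then 1 + \int[mu]_(s in `[0, y]) (w s)^-1
  else if y <= x + d then
    1 + \int[mu]_(s in `[0, x]) (w s)^-1
      + \int[mu]_(s in `[0, y - x]) ((d - s) / (d * w (s + x)))
  else
    1 + \int[mu]_(s in `[0, x]) (w s)^-1
      + \int[mu]_(s in `[0, d]) ((d - s) / (d * w (s + x))).

End forward_prices.

(* Main.v *)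
Require Import Defs.
From HB Require Import structures.
From mathcomp Require Import all_boot all_order all_algebra.
From mathcomp Require Import all_classical all_reals all_analysis.
From mathcomp Require Import measurable_realfun ring lra.
Import Order.TTheory GRing.Theory Num.Theory.
Import numFieldNormedType.Exports.
Local Open Scope classical_set_scope.
Local Open Scope ring_scope.
Set Implicit Arguments.
Unset Strict Implicit.
Unset Printing Implicit Defensive.

(** Every f in H_w satisfies f(y) = f(0) + int_0^y f' ([weak_deriv_primitive]),
    so averaging f over [x, x + d] and integrating by parts on that interval
    against (s - x - d) / d gives
      f(0) + int_0^x f'(s) ds + int_x^{x+d} f'(s) (x + d - s) / d ds,
    that is f(0) + int_0^oo f' r, where r(s) is the proportion of the delivery
    period lying after s. Writing r = (r / w) w exhibits this as the inner
    product of f with the function of value 1 at 0 and derivative r / w, which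
    is [delivery_fun] ([delivery_fun_primitive]). It belongs to H_w since it is
    1-Lipschitz and (r / w)^2 w <= 1 / w is integrable.

    Derivatives being only weak, two facts carry the argument. A locally
    absolutely continuous function is the primitive of its weak derivative
    ([weak_deriv_increment]): the weak derivative is tested against smooth
    approximations of indicators of intervals, built from exp(-1/x). Conversely
    a primitive has its density as weak derivative, by the integration by parts
    [Rintegral_by_parts], which is Fubini on a triangle. Uniqueness of the
    primitive and Lebesgue differentiation ([ae_eq0_Rintegral]) then identify
    the derivative chosen in the definition of the inner product with r / w
    almost everywhere ([weak_deriv_unique]). *)

(** * Smooth functions and a smooth step *)

Section smooth_functions.
Variable R : realType.
Implicit Types (f g : R -> R) (a b c x : R) (n k : nat).

(** [f] is [n] times differentiable on the whole line, with the successive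
    derivatives as explicit witnesses. *)
Fixpoint nderivable n f : Prop := match n with
  | 0 => True
  | m.+1 => exists2 f', (forall x, is_derive x 1 f (f' x)) & nderivable m f'
  end.

Lemma nderivableW n f : nderivable n.+1 f -> nderivable n f.
Proof.
elim: n f => [//|n IH] f [f' df Cf']; exists f' => //; exact: IH.
Qed.

Lemma nderivable_cst n c : nderivable n (fun=> c).
Proof.
elim: n c => [//|n IH] c; exists (fun=> 0) => //.
by move=> x; exact: is_derive_cst.
Qed.

Lemma nderivableD n f g :
  nderivable n f -> nderivable n g -> nderivable n (f \+ g).
Proof.
elim: n f g => [//|n IH] f g [f' df Cf] [g' dg Cg].
by exists (f' \+ g'); [move=> x; exact: is_deriveD|exact: IH].
Qed.

Lemma nderivableM n f g :
  nderivable n f -> nderivable n g -> nderivable n (f \* g).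
Proof.
elim: n f g => [//|n IH] f g Cf Cg.
have [/nderivableW Cf0 /nderivableW Cg0] := (Cf, Cg).
case: Cf => f' df Cf; case: Cg => g' dg Cg.
exists ((f \* g') \+ (g \* f')); last by apply: nderivableD; exact: IH.
move=> x; have := is_deriveM (df x) (dg x).
by move=> /is_derive_eq; apply.
Qed.

Lemma nderivableV n f : (forall x, f x != 0) ->
  nderivable n f -> nderivable n (fun x => (f x)^-1).
Proof.
move=> f0; elim: n => [//|n IH] Cf.
have iC := IH (nderivableW Cf); case: Cf => f' df Cf.
exists (((fun=> -1) \* f') \* ((fun x => (f x)^-1) \* (fun x => (f x)^-1))).
  move=> x; have := is_deriveV (f0 x) (df x).
  move=> /is_derive_eq; apply; rewrite /GRing.scale/=.
  by rewrite -expr2 exprVn mulN1r mulrC mulrN mulNr.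
apply: nderivableM; last exact: nderivableM.
by apply: nderivableM => //; exact: nderivable_cst.
Qed.

Lemma nderivable_affine n f a b :
  nderivable n f -> nderivable n (fun x => f (a * x + b)).
Proof.
elim: n f => [//|n IH] f [f' df Cf].
exists ((fun=> a) \* (fun x => f' (a * x + b))).
  move=> x; have dl : is_derive x 1 (fun x : R => a * x + b) a.
    have := is_deriveD (is_deriveZ a (is_derive_id x 1)) (is_derive_cst b x 1).
    by move=> /is_derive_eq; apply; rewrite /GRing.scale/= mulr1 addr0.
  have := @is_derive1_comp _ f (fun x => a * x + b) x _ _ (df _) dl.
  by move=> /is_derive_eq; apply; rewrite /= mulrC.
by apply: nderivableM; [exact: nderivable_cst|exact: IH].
Qed.

Lemma nderivable_derivable f : (forall n, nderivable n f) ->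
  forall n x, derivable (derive1n n f) x 1.
Proof.
move=> Cf n x; move: {Cf}(Cf n.+1); elim: n f => [|n IH] f.
  by case=> f' /(_ x)[].
case=> f' df Cf'; rewrite derive1Sn.
have -> : f^`()%classic = f'.
  by apply/funext => y; rewrite derive1E; case: (df y).
exact: IH.
Qed.

(** The flat functions equal to exp(-1/x) / x^k for x > 0 and to 0 for x <= 0.
    Their derivatives are linear combinations of functions of the same family,
    hence they are smooth. *)
Definition flat k x : R := if 0 < x then x^-1 ^+ k * expR (- x^-1) else 0.

Lemma flat_ge0 k x : 0 <= flat k x.
Proof.
rewrite /flat; case: ifPn => // x0.
by rewrite mulr_ge0 ?expR_ge0// exprn_ge0// invr_ge0 ltW.
Qed.

(** Quadratic decay at the origin, which gives the derivative 0 there; it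
    comes from the term of degree k + 2 of the exponential series at 1/x. *)
Lemma flat_le k x : flat k x <= (k.+2)`!%:R * x ^+ 2.
Proof.
rewrite /flat; case: ifPn => x0; last by rewrite mulr_ge0// sqr_ge0.
have y0 : 0 < x^-1 by rewrite invr_gt0.
have := expR_ge1Dxn k.+1 (ltW y0).
have fp : 0 < (k.+2)`!%:R :> R by rewrite ltr0n fact_gt0.
move=> /(le_trans _) H; have {}H : x^-1 ^+ k.+2 / (k.+2)`!%:R <= expR x^-1.
  by apply: H; rewrite lerDr.
rewrite expRN ler_pdivrMr ?expR_gt0//.
have -> : x^-1 ^+ k = x^-1 ^+ k.+2 / (k.+2)`!%:R * ((k.+2)`!%:R * x ^+ 2).
  by rewrite !exprS; field; rewrite !lt0r_neq0.
by rewrite mulrC ler_wpM2l// mulr_ge0 ?sqr_ge0.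
Qed.

Lemma is_derive_flat k x :
  is_derive x 1 (flat k) (- k%:R * flat k.+1 x + flat k.+2 x).
Proof.
have [x0|x0|x0] := ltgtP x 0.
- rewrite {2 3}/flat !ltNge ltW//= mulr0 addr0.
  apply: (@near_eq_is_derive _ _ _ (fun=> 0)).
  near=> y; rewrite /flat ltNge ltW//=.
  by near: y; exact: lt_nbhsl.
- have xN0 : x != 0 by rewrite gt_eqF.
  have dV : is_derive x 1 (fun y : R => y^-1) (- x ^- 2).
    have := @is_deriveV _ id x 1 1 xN0 (is_derive_id x 1).
    by move=> /is_derive_eq; apply; rewrite /GRing.scale/= mulr1.
  have dX : is_derive x 1 (fun y : R => y^-1 ^+ k)
      (- k%:R * x^-1 ^+ k.+1).
    case: k => [|k]; first by rewrite oppr0 mul0r; exact: is_derive_cst.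
    have := is_deriveX k.+1 dV; rewrite exprfctE.
    move=> /is_derive_eq; apply; rewrite /GRing.scale/= !exprS.
    by rewrite -mulr_natl; field.
  have dE : is_derive x 1 (fun y : R => expR (- y^-1)) (x ^- 2 * expR (- x^-1)).
    have := @is_derive1_comp _ (@expR R) (fun y => - y^-1) x _ _
       (is_derive_expR _) (is_deriveN dV).
    by move=> /is_derive_eq; apply; rewrite /= opprK mulrC.
  have dM : is_derive x 1 (fun y => y^-1 ^+ k * expR (- y^-1))
      (- k%:R * flat k.+1 x + flat k.+2 x).
    have := is_deriveM dX dE; move=> /is_derive_eq; apply.
    by rewrite /GRing.scale/= /flat x0 !exprS; field.
  apply: near_eq_is_derive dM.
  by near=> y; rewrite /flat ifT//; near: y; exact: lt_nbhsr.
- rewrite x0 {2 3}/flat ltxx mulr0 addr0.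
  have flat0 : flat k 0 = 0 by rewrite /flat ltxx.
  suff D : h^-1 *: (flat k (h *: 1 + 0) - flat k 0) @[h --> 0^'] --> (0 : R).
    by split; [apply/cvg_ex; exists 0|exact: cvg_lim D].
  apply/cvgrPdist_le => e e0.
  have fp : 0 < (k.+2)`!%:R :> R by rewrite ltr0n fact_gt0.
  near=> h.
  have h0 : h != 0 by near: h; exact: nbhs_dnbhs_neq.
  rewrite flat0 subr0 addr0 sub0r normrN /GRing.scale/= mulr1.
  rewrite normrM normfV ler_pdivrMl ?normr_gt0// (ger0_norm (flat_ge0 _ _)).
  rewrite (le_trans (flat_le _ _))// -real_normK ?num_real// mulrC expr2 -mulrA.
  rewrite ler_wpM2l// -ler_pdivlMr//.
  near: h; apply: dnbhs0_le; exact: divr_gt0.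
Unshelve. all: by end_near. Qed.

Lemma nderivable_flat n k : nderivable n (flat k).
Proof.
elim: n k => [//|n IH] k.
exists (((fun=> - k%:R) \* flat k.+1) \+ flat k.+2).
  exact: is_derive_flat.
by apply: nderivableD => //; apply: nderivableM => //; exact: nderivable_cst.
Qed.

Lemma flat_gt0 x : 0 < x -> 0 < flat 0 x.
Proof. by move=> x0; rewrite /flat x0 expr0 mul1r expR_gt0. Qed.

Lemma flat_eq0 k x : x <= 0 -> flat k x = 0.
Proof. by move=> x0; rewrite /flat ltNge x0. Qed.

(** A smooth transition from 0 to 1 on the unit interval: the quotient
    e(x) / (e(x) + e(1 - x)) with e(x) = exp(-1/x) for x > 0. *)
Lemma smooth_step : exists s : R -> R,
  [/\ forall n, nderivable n s, forall x, x <= 0 -> s x = 0,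
      forall x, 1 <= x -> s x = 1 & forall x, 0 <= s x <= 1].
Proof.
pose D := flat 0 \+ (fun x => flat 0 (-1 * x + 1)).
have D0 x : 0 < D x.
  rewrite /D /=; have [x0|x0] := ltP 0 x.
    by rewrite ltr_pwDl ?flat_gt0// flat_ge0.
  by rewrite ltr_wpDl ?flat_ge0// flat_gt0//; lra.
exists (flat 0 \* (fun x => (D x)^-1)); split.
- move=> n; apply: nderivableM; first exact: nderivable_flat.
  apply: nderivableV => [x|]; first by rewrite gt_eqF.
  by apply: nderivableD; [|apply: nderivable_affine]; exact: nderivable_flat.
- by move=> x x0 /=; rewrite flat_eq0// mul0r.
- move=> x x1 /=; have x0 : 0 < x by lra.
  rewrite /D /= (@flat_eq0 _ (-1 * x + 1)); last by lra.
  by rewrite addr0 divff// gt_eqF// flat_gt0.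
- move=> x /=; rewrite divr_ge0 ?flat_ge0 ?(ltW (D0 _))//=.
  by rewrite ler_pdivrMr// mul1r lerDl flat_ge0.
Qed.

End smooth_functions.

(** * Integration by parts and integrals over intervals *)

Section integrals_generic.
Context d (T : measurableType d) (R : realType).
Variable mu : {measure set T -> \bar R}.
Implicit Types (f g h : T -> R).

Lemma EFin_Rint (D : set T) f : measurable D -> mu.-integrable D (EFin \o f) ->
  (\int[mu]_(x in D) (f x)%:E)%E = (\int[mu]_(x in D) f x)%:E.
Proof.
by move=> mD fi; rewrite /Rintegral fineK//; exact: integrable_fin_num fi.
Qed.

Lemma integrable_mul_bounded (D : set T) f g (M : R) : measurable D ->
  mu.-integrable D (EFin \o f) -> measurable_fun D g ->
  (forall x, D x -> `|g x| <= M) ->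
  mu.-integrable D (EFin \o (fun x => f x * g x)).
Proof.
move=> mD fi mg gM.
have Mf := integrableZl mD M fi.
apply: le_integrable Mf => //.
  apply/measurable_EFinP; apply: measurable_funM => //.
  by apply/measurable_EFinP; exact: measurable_int fi.
move=> x Dx /=; rewrite lee_fin !normrM mulrC ler_wpM2r//.
by rewrite (le_trans (gM _ Dx))// ler_norm.
Qed.

End integrals_generic.

Section integrals.
Variable R : realType.
Local Notation mu := (@lebesgue_measure R).
Implicit Types (f g h : R -> R) (a b c x : R).

Lemma integrable_restrict_itv f a b :
  mu.-integrable `[a, b] (EFin \o f) ->
  mu.-integrable setT (EFin \o (f \_ `[a, b])).
Proof.
by move=> fi; rewrite -restrict_EFin; apply/(integrable_mkcond _ _).1.
Qed.

(** Exchange of the order of integration over the triangle a <= s <= x <= b. *)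
Lemma Rintegral_triangle a b g h :
  mu.-integrable `[a, b] (EFin \o g) -> mu.-integrable `[a, b] (EFin \o h) ->
  \int[mu]_(x in `[a, b]) ((\int[mu]_(s in `[a, x]) g s) * h x) =
  \int[mu]_(s in `[a, b]) (g s * \int[mu]_(x in `[s, b]) h x).
Proof.
move=> gi hi.
pose TR : measurableType _ := measurableTypeR R.
pose g1 : TR -> R := g \_ `[a, b]; pose h1 : TR -> R := h \_ `[a, b].
have g1i : mu.-integrable [set: TR] (EFin \o g1).
  by exact: integrable_restrict_itv.
have h1i : mu.-integrable [set: TR] (EFin \o h1).
  by exact: integrable_restrict_itv.
have mg1 : measurable_fun setT g1.
  by apply/measurable_EFinP; exact: measurable_int g1i.
have mh1 : measurable_fun setT h1.
  by apply/measurable_EFinP; exact: measurable_int h1i.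
pose A := [set z : TR * TR | z.2 <= z.1].
have mA : measurable A.
  have : measurable_fun setT (fun z : TR * TR => z.2 <= z.1).
    by apply: measurable_fun_ler; [exact: measurable_snd|exact: measurable_fst].
  by move=> /(_ measurableT [set true]); rewrite setTI; exact.
pose k (z : TR * TR) : R := g1 z.2 * h1 z.1 * \1_A z.
have mk : measurable_fun setT k.
  apply: measurable_funM; last exact: measurable_indic.
  by apply: measurable_funM; exact: measurableT_comp.
have kE x s : k (x, s) = g1 s * h1 x * (s <= x)%R%:R.
  rewrite /k indicE; congr (_ * _); congr (_%:R); congr nat_of_bool.
  by apply/idP/idP => [/set_mem//|?]; exact/mem_set.
(* the integrand is dominated by the product of |h1| and |g1| *)
have ki : (mu \x mu)%E.-integrable setT (EFin \o k).
  apply/integrable12ltyP; first exact/measurable_EFinP.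
  have [_ gy] := integrableP _ _ _ g1i; have [mh hy] := integrableP _ _ _ h1i.
  apply: (@le_lt_trans _ _ (\int[mu]_x (`|(h1 x)%:E| *
      \int[mu]_s `|(g1 s)%:E|)))%E.
    apply: ge0_le_integral => //.
    + by move=> x _; exact: integral_ge0.
    - apply: (measurable_fun_fubini_tonelli_F (abse \o (EFin \o k))) => //.
        by apply: measurableT_comp => //; exact/measurable_EFinP.
      by move=> z /=; rewrite lee_fin.
    - apply: emeasurable_funM; last exact: measurable_cst.
      by apply: measurableT_comp => //; exact/measurable_EFinP.
    - move=> x _; rewrite -ge0_integralZl//; last first.
        by apply: measurableT_comp => //; exact/measurable_EFinP.
      apply: ge0_le_integral => //.
      + by apply: measurableT_comp => //; apply/measurable_EFinP;
          exact: measurableT_comp.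
      + apply: emeasurable_funM; first exact: measurable_cst.
        by apply: measurableT_comp => //; exact/measurable_EFinP.
      + move=> s _; rewrite /= lee_fin kE !normrM mulrC [_ * `|h1 x|]mulrC.
        rewrite ler_piMl ?mulr_ge0//.
        by case: (s <= x); rewrite ?normr1 ?normr0.
  rewrite ge0_integralZr//.
  + have h0 : (0 <= \int[mu]_x `|(h1 x)%:E|)%E by exact: integral_ge0.
    by apply: lte_mul_pinfty; rewrite // ge0_fin_numE.
  + by apply: measurableT_comp => //; exact/measurable_EFinP.
  + exact: integral_ge0.
have hiS s : mu.-integrable `[s, b] (EFin \o h1).
  by apply: integrableS h1i.
have giS x : mu.-integrable `[a, x] (EFin \o g1).
  by apply: integrableS g1i.
have := Fubini ki; rewrite /=.
under eq_integral => x _.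
  have -> : (\int[mu]_s (k (x, s))%:E)%E =
      ((fun x => (\int[mu]_(s in `[a, x]) g s) * h x) \_ `[a, b] x)%:E.
    rewrite patchE; case: ifPn => [|xab]; last first.
      rewrite (eq_integral (fun=> 0%E)) ?integral0// => s _.
      by rewrite kE /h1 patchE (negbTE xab) mulr0 mul0r.
    rewrite inE/= in_itv/= => /andP[ax xb].
    transitivity (\int[mu]_(s in `[a, x]) ((h x)%:E * (g s)%:E))%E; last first.
      have gix : mu.-integrable `[a, x] (EFin \o g).
        by apply: integrableS gi => //; apply: subset_itvl; rewrite bnd_simp.
      by rewrite integralZl// EFin_Rint// EFinM muleC.
    rewrite [RHS]integral_mkcond; apply: eq_integral => s _.
    rewrite kE /g1 /h1 !patchE !mem_setE !in_itv/= ax xb/=.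
    case: (leP a s) => //= as_; rewrite ?mul0r//.
    case: (leP s x) => sx/=; last by rewrite mulr0.
    by rewrite (le_trans sx xb) mulr1 mulrC EFinM.
  over.
under [in X in _ = X -> _]eq_integral => s _.
  have -> : (\int[mu]_x (k (x, s))%:E)%E =
      ((fun s => g s * \int[mu]_(x in `[s, b]) h x) \_ `[a, b] s)%:E.
    rewrite patchE; case: ifPn => [|sab]; last first.
      rewrite (eq_integral (fun=> 0%E)) ?integral0// => x _.
      by rewrite kE /g1 patchE (negbTE sab) mul0r mul0r.
    rewrite inE/= in_itv/= => /andP[as_ sb].
    transitivity (\int[mu]_(x in `[s, b]) ((g s)%:E * (h x)%:E))%E; last first.
      have his : mu.-integrable `[s, b] (EFin \o h).
        by apply: integrableS hi => //; apply: subset_itvr; rewrite bnd_simp.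
      by rewrite integralZl// EFin_Rint// EFinM.
    rewrite [RHS]integral_mkcond; apply: eq_integral => x _.
    rewrite kE /g1 /h1 !patchE !mem_setE !in_itv/= as_ sb/=.
    case: (leP x b) => //= xb; rewrite ?andbF ?mulr0 ?mul0r//.
    case: (leP s x) => sx/=; last by rewrite mulr0.
    by rewrite (le_trans as_ sx) mulr1 EFinM.
  over.
move=> /(congr1 fine).
by rewrite [LHS]/= [RHS]/= -!/(Rintegral _ _ _) -!Rintegral_mkcond.
Qed.

Lemma integrable_mul_continuous a b f g :
  mu.-integrable `[a, b] (EFin \o f) -> {within `[a, b], continuous g} ->
  mu.-integrable `[a, b] (EFin \o (fun x => f x * g x)).
Proof.
move=> fi cg.
have [M [_ gM]] := compact_bounded
  (continuous_compact cg (@segment_compact _ a b)).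
apply: (@integrable_mul_bounded _ _ _ _ _ _ _ (`|M| + 1)) => //.
  exact: subspace_continuous_measurable_fun.
move=> x abx; apply: (gM (`|M| + 1)); last by exists x.
by rewrite (le_lt_trans (ler_norm _))// ltrDl.
Qed.

Lemma continuous_itv_integrable a b f : {within `[a, b], continuous f} ->
  mu.-integrable `[a, b] (EFin \o f).
Proof.
move=> cf; apply: continuous_compact_integrable => //.
exact: segment_compact.
Qed.

Lemma is_derive_continuous f g : (forall x, is_derive x 1 f (g x)) ->
  continuous f.
Proof.
by move=> df x; apply/differentiable_continuous/derivable1_diffP; case: (df x).
Qed.

Lemma Rintegral_derive a b f g : a <= b ->
  (forall x, is_derive x 1 f (g x)) -> continuous g ->
  \int[mu]_(x in `[a, b]) g x = f b - f a.
Proof.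
rewrite le_eqVlt => /predU1P[<-|ab] df cg.
  by rewrite set_itv1 Rintegral_set1 subrr.
have cf := is_derive_continuous df.
rewrite /Rintegral (@continuous_FTC2 _ g f)//.
- exact: continuous_subspaceT.
- split; first by move=> x _; case: (df x).
  + by apply: cvg_at_right_filter; exact: cf.
  + by apply: cvg_at_left_filter; exact: cf.
- by move=> x _; rewrite derive1E; case: (df x).
Qed.

(** Integration by parts of an absolutely continuous function, given by its
    integrable density [g], against a continuously differentiable one. *)
Lemma Rintegral_by_parts a b c g f f' : a <= b ->
  mu.-integrable `[a, b] (EFin \o g) ->
  (forall x, is_derive x 1 f (f' x)) -> continuous f' ->
  \int[mu]_(x in `[a, b]) ((c + \int[mu]_(s in `[a, x]) g s) * f' x) =
  (c + \int[mu]_(s in `[a, b]) g s) * f b - c * f a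
  - \int[mu]_(s in `[a, b]) (g s * f s).
Proof.
move=> ab gi df cf'.
have cf := is_derive_continuous df.
have f'i : mu.-integrable `[a, b] (EFin \o f').
  exact/continuous_itv_integrable/continuous_subspaceT.
have gfi : mu.-integrable `[a, b] (EFin \o (fun s => g s * f s)).
  by apply: integrable_mul_continuous => //; exact: continuous_subspaceT.
have Gi : mu.-integrable `[a, b]
    (EFin \o (fun x => (\int[mu]_(s in `[a, x]) g s) * f' x)).
  apply: integrable_mul_continuous; last exact: continuous_subspaceT.
  exact/continuous_itv_integrable/parameterized_integral_continuous.
have cf'i : mu.-integrable `[a, b] (EFin \o (fun x => c * f' x)).
  exact: integrableZl f'i.
under eq_Rintegral do rewrite mulrDl.
rewrite RintegralD// RintegralZl// (Rintegral_derive ab df cf').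
rewrite Rintegral_triangle//.
rewrite (@eq_Rintegral _ _ _ mu `[a, b]
  (fun s => g s * f b - g s * f s)); last first.
  move=> s; rewrite inE/= in_itv/= => /andP[as_ sb].
  by rewrite (Rintegral_derive sb df cf') mulrBr.
rewrite RintegralB//; last exact: integrableZr gi.
rewrite RintegralZr//; ring.
Qed.

End integrals.

(** * Translation of integrals, and functions with vanishing primitive *)

Section shift.
Variable R : realType.
Local Notation mu := (@lebesgue_measure R).
Implicit Types (f g h : R -> R) (a b c x : R).

Let TR : measurableType _ := measurableTypeR R.

Let shift c : TR -> TR := fun x => x + c.

Let measurable_shift c : measurable_fun [set: TR] (shift c).
Proof. by apply: measurable_funD => //; exact: measurable_id. Qed.

Lemma lebesgue_measure_shift c (A : set TR) : measurable A ->
  pushforward mu (shift c) A = mu A.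
Proof.
move=> mA; apply/esym/lebesgue_measure_unique => //=.
move=> _ [[u v]] _ <-; rewrite /pushforward.
have -> : shift c @^-1` `]u, v] = `](u - c), (v - c)]%classic.
  by apply/seteqP; split => x; rewrite /shift /= !in_itv/= ltrBlDr lerBrDr.
rewrite !lebesgue_measure_itv/= !lte_fin ltrD2r.
by case: ifP => // _; rewrite -!EFinB opprB addrA subrK.
Qed.

Lemma Rintegral_shift a b c f :
  mu.-integrable `[a + c, b + c] (EFin \o f) ->
  \int[mu]_(x in `[a, b]) f (x + c) = \int[mu]_(x in `[a + c, b + c]) f x.
Proof.
move=> fi.
pose D : set TR := `[a + c, b + c]%classic.
have mD : measurable D by exact: measurable_itv.
have pD : shift c @^-1` D = `[a, b]%classic.
  by apply/seteqP; split => x; rewrite /shift /D /= !in_itv/= !lerD2r.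
pose g : TR -> \bar R := EFin \o (f \_ D).
have gi : mu.-integrable [set: TR] g by exact: integrable_restrict_itv.
have mg : measurable_fun [set: TR] g by exact: measurable_int gi.
have gci : mu.-integrable (shift c @^-1` D) (g \o shift c).
  apply/integrableP; split.
    by apply: measurable_funTS; exact: measurableT_comp.
  have ag : measurable_fun [set: TR] (abse \o g) by exact: measurableT_comp.
  have <- := @ge0_integral_pushforward _ _ _ _ _ _ (measurable_shift c) mu D
    (abse \o g) mD (measurable_funTS ag) (fun x _ => abse_ge0 (g x)).
  rewrite (eq_measure_integral mu); last first.
    by move=> A mA _; exact: lebesgue_measure_shift.
  have /integrableP[_] : mu.-integrable D g by exact: integrableS gi.
  by [].
have := integral_pushforward (measurable_shift c) mg gci mD.
rewrite pD (eq_measure_integral mu); last first.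
  by move=> A mA _; exact: lebesgue_measure_shift.
move=> /(congr1 fine) H.
transitivity (\int[mu]_(x in `[a, b]) ((f \_ D) (x + c))).
  apply: eq_Rintegral => x; rewrite inE/= in_itv/= => abx.
  by rewrite patchE /D mem_setE in_itv/= !lerD2r abx.
rewrite /Rintegral -H -/(Rintegral _ _ _).
by apply: eq_Rintegral => x xD; rewrite patchE xD.
Qed.

(** By Lebesgue differentiation of the vanishing primitive of [f], truncated
    to [0, n] so as to be integrable on the whole line. *)
Lemma ae_eq0_Rintegral f :
  (forall b, mu.-integrable `[0, b] (EFin \o f)) ->
  (forall b, \int[mu]_(x in `[0, b]) f x = 0) ->
  {ae mu, forall x, 0 <= x -> f x = 0}.
Proof.
move=> fi f0.
have H n : {ae mu, forall x, 0 <= x <= n%:R -> f x = 0}.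
  pose g := f \_ `[0, n%:R].
  have gi : mu.-integrable setT (EFin \o g) by exact: integrable_restrict_itv.
  have gL : locally_integrable [set: R] g by exact: integrable_locally.
  have giS y :
      mu.-integrable [set` Interval (BLeft (-1)) (BRight y)] (EFin \o g).
    exact: integrableS gi.
  (* the primitive starts at -1 so that 0 is an interior point *)
  have := FTC1 giS gL; apply: filterS.
    exact: (ae_filter_ringOfSetsType mu).
  move=> x /= + /andP[x0 xn].
  have xN1 : ((- 1)%:E < x%:E)%E by rewrite lte_fin (lt_le_trans _ x0).
  move=> /(_ xN1)[_].
  have -> : (fun x => \int[mu]_(t in `[- 1, x]) g t) = fun=> 0.
    apply/funext => y; rewrite /g -Rintegral_mkcondr.
    transitivity (\int[mu]_(x in `[0, Num.min y n%:R]) f x); last exact: f0.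
    congr Rintegral; apply/seteqP; split => z /=; rewrite !in_itv/= le_min.
      by move=> [/andP[_ ->] /andP[-> ->]].
    by move=> /and3P[z0 -> ->]; rewrite z0 (le_trans _ z0).
  by rewrite derive1_cst /g patchE mem_setE in_itv/= x0 xn.
have := ae_foralln H; apply: filterS.
move=> x fx x0.
apply: (fx (Num.truncn x).+1); rewrite x0/=.
by rewrite ltW// Num.Theory.truncnS_gt.
Qed.

End shift.

(** * Weak derivatives and primitives *)

Section mollification.
Variable R : realType.
Local Notation mu := (@lebesgue_measure R).
Implicit Types (f g h phi : R -> R) (a b c x y N : R).

Lemma Rintegral_support (D E : set R) h : E `<=` D ->
  (forall x, D x -> ~ E x -> h x = 0) ->
  \int[mu]_(x in D) h x = \int[mu]_(x in E) h x.
Proof.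
move=> ED h0; rewrite Rintegral_mkcond [RHS]Rintegral_mkcond.
congr Rintegral; apply/funext => x; rewrite !patchE.
have [/set_mem xD|/negP xD] := boolP (x \in D); last first.
  by rewrite ifF//; apply/negP => /set_mem/ED xD'; apply: xD; exact/mem_set.
have [//|/negP xE] := boolP (x \in E).
by apply: h0 => // Ex; apply: xE; exact/mem_set.
Qed.

Lemma integrable_support (i j : interval R) h : [set` i] `<=` [set` j] ->
  (forall x, [set` j] x -> ~ [set` i] x -> h x = 0) ->
  mu.-integrable [set` i] (EFin \o h) -> mu.-integrable [set` j] (EFin \o h).
Proof.
move=> ij h0 hi; apply/integrable_mkcond => //.
suff -> : (EFin \o h) \_ [set` j] = (EFin \o h) \_ [set` i].
  by apply/(integrable_mkcond _ _).1.
apply/funext => x; rewrite !patchE.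
have [/set_mem xD|/negP xD] := boolP (x \in [set` j]); last first.
  by rewrite ifF//; apply/negP => /set_mem/ij xD'; apply: xD; exact/mem_set.
have [//|/negP xE] := boolP (x \in [set` i]).
by rewrite /= h0// => Ex; apply: xE; exact/mem_set.
Qed.

Lemma loc_abs_cont_uniform f (L e : R) : loc_abs_cont f -> 0 < e ->
  exists2 dl, 0 < dl & forall x y, 0 <= x -> x <= y -> y <= L ->
    y - x < dl -> `|f y - f x| < e.
Proof.
move=> fac e0; have [dl dl0 H] := fac L e e0.
exists dl => // x y x0 xy yL yx.
have := H 1%N (fun=> x) (fun=> y); rewrite !big_ord1; apply => //.
by move=> i j; rewrite !ord1 eqxx.
Qed.

Lemma is_derive_rescale f g N c x : (forall y, is_derive y 1 f (g y)) ->
  is_derive x 1 (fun y => f (N * (y - c))) (N * g (N * (x - c))).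
Proof.
move=> df; have dl : is_derive x 1 (fun y : R => N * (y - c)) N.
  have := is_deriveZ N (is_deriveB (is_derive_id x 1) (is_derive_cst c x 1)).
  by move=> /is_derive_eq; apply; rewrite /GRing.scale/= subr0 mulr1.
have := @is_derive1_comp _ f (fun y => N * (y - c)) x _ _ (df _) dl.
by move=> /is_derive_eq; apply; rewrite /= mulrC.
Qed.

Lemma continuous_rescale g N c : continuous g ->
  continuous (fun x => N * g (N * (x - c))).
Proof.
move=> cg x; apply: cvgM; first exact: cvg_cst.
apply: (@continuous_comp _ _ _ (fun x => N * (x - c)) g); last exact: cg.
apply: cvgM; first exact: cvg_cst.
by apply: cvgB; [exact: cvg_id|exact: cvg_cst].
Qed.

(** Averages of [f] against the rescaled density [s'] of a step concentrate at
    the left end point of the interval of integration. *)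
Lemma cvg_mollify (s s' : R -> R) f c :
  (forall x, is_derive x 1 s (s' x)) -> continuous s' -> s 0 = 0 -> s 1 = 1 ->
  mu.-integrable `[c, c + 1] (EFin \o f) ->
  f x @[x --> c^'+] --> f c ->
  \int[mu]_(x in `[c, c + n.+1%:R^-1])
      (f x * (n.+1%:R * s' (n.+1%:R * (x - c))))
    @[n --> \oo] --> f c.
Proof.
move=> ds cs' s0 s1 fi fc.
(* bound of [s'] on the unit interval, so that the error is at most M times
   the oscillation of [f] near [c] *)
have [M M0 s'M] : exists2 M : R, 0 < M & forall x, 0 <= x <= 1 -> `|s' x| <= M.
  have cw : {within `[0, 1], continuous s'} by exact: continuous_subspaceT.
  have [M [_ sM]] := compact_bounded
    (continuous_compact cw (@segment_compact _ 0 1)).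
  exists (`|M| + 1); first by rewrite ltr_wpDl.
  move=> x x01; apply: (sM (`|M| + 1)); last by exists x => //=; rewrite in_itv.
  by rewrite (le_lt_trans (ler_norm _))// ltrDl.
apply/cvgrPdist_le => e e0.
have eM : 0 < e / M by exact: divr_gt0.
have /cvgrPdist_le/(_ _ eM) := fc.
move=> -[/= dl dl0 fdl].
have := near_infty_natSinv_lt (PosNum dl0); apply: filterS => n /= nd.
set N : R := n.+1%:R; set D : set (measurableTypeR R) := `[c, c + N^-1]%classic.
have mD : measurable D by exact: measurable_itv.
have N0 : 0 < N by rewrite /N.
have N1 : N^-1 <= 1 by rewrite invf_le1// /N ler1n.
pose k x := N * s' (N * (x - c)).
have dk x : is_derive x 1 (fun x => s (N * (x - c))) (k x).
  exact: is_derive_rescale.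
have ck : continuous k by exact: continuous_rescale.
have cNc : c <= c + N^-1 by rewrite lerDl invr_ge0 ltW.
have Ik : \int[mu]_(x in D) k x = 1.
  rewrite (Rintegral_derive cNc dk ck) subrr mulr0 s0 subr0.
  by rewrite addrC addKr mulfV ?s1// gt_eqF.
have fiD : mu.-integrable D (EFin \o f).
  apply: integrableS fi => //; rewrite /D; apply: subset_itvl.
  by rewrite bnd_simp lerD2l.
have kiD : mu.-integrable D (EFin \o k).
  exact/continuous_itv_integrable/continuous_subspaceT.
have fkiD : mu.-integrable D (EFin \o (fun x => f x * k x)).
  by apply: integrable_mul_continuous => //; exact: continuous_subspaceT.
have ckiD : mu.-integrable D (EFin \o (fun x => f c * k x)).
  exact: integrableZl kiD.
have -> : f c = \int[mu]_(x in D) (f c * k x) by rewrite RintegralZl// Ik mulr1.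
rewrite -RintegralB//.
have iB := integrableB mD ckiD fkiD.
apply: (le_trans (le_normr_Rintegral mD iB)).
have muD : mu D = (N^-1)%:E.
  apply: etrans (lebesgue_measure_itv _) _ => /=.
  by rewrite lte_fin ltrDl invr_gt0 N0 -EFinB addrC addKr.
have -> : e = \int[mu]_(x in D) (e * N).
  rewrite Rintegral_cst// (_ : fine _ = N^-1) ?mulfK ?gt_eqF//.
  exact: (congr1 fine muD).
apply: le_Rintegral => //.
- exact: (@integrable_norm _ _ _ mu D (fun x => f c * k x - f x * k x)).
- by apply: continuous_itv_integrable => x; exact: cvg_cst.
- move=> x; rewrite /D/= in_itv/= => /andP[cx xc].
  rewrite /k; set sx := s' _.
  rewrite (_ : _ - _ = N * ((f c - f x) * sx)); last by ring.
  rewrite normrM (gtr0_norm N0) (mulrC e) ler_wpM2l ?(ltW N0)//.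
  rewrite normrM -(divfK (lt0r_neq0 M0) e) ler_pM//; last first.
    apply: s'M; rewrite mulr_ge0 ?subr_ge0 ?(ltW N0)//=.
    by rewrite -ler_pdivlMl// mulr1 lerBlDl.
  have [->|cx'] := eqVneq x c; first by rewrite subrr normr0 ltW.
  apply: fdl; last by rewrite lt_neqAle eq_sym cx' cx.
  rewrite /= distrC ger0_norm ?subr_ge0//.
  by rewrite (le_lt_trans _ nd)// lerBlDl.
Qed.

End mollification.

Section increments.
Variable R : realType.
Local Notation mu := (@lebesgue_measure R).
Implicit Types (f g h phi : R -> R) (a b c x y : R).

Lemma loc_abs_cont_cvg_right f c : loc_abs_cont f -> 0 <= c ->
  f x @[x --> c^'+] --> f c.
Proof.
move=> fac c0; apply/cvgrPdist_lt => e e0.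
have [dl dl0 H] := loc_abs_cont_uniform (c + 1) fac e0.
near=> x.
have cx : c < x by near: x; exact: nbhs_right_gt.
have xc1 : x <= c + 1 by near: x; apply: nbhs_right_le; rewrite ltrDl.
have xcd : x - c < dl by near: x; exact: nbhs_right_ltDr.
by rewrite distrC; apply: (H c x c0 (ltW cx) xc1 xcd).
Unshelve. all: by end_near. Qed.

Lemma is_derive_near_cst f x c d : (\near x, f x = c) -> is_derive x 1 f d ->
  d = 0.
Proof.
move=> fc [_ <-].
by rewrite (@near_eq_derive _ _ _ f (cst c))// derive_cst.
Qed.

Lemma L1loc_sub f a b : L1loc f -> 0 <= a ->
  mu.-integrable `[a, b] (EFin \o f).
Proof.
move=> fi a0; apply: integrableS (fi b) => //.
by apply: subset_itvr; rewrite bnd_simp.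
Qed.

(** Testing the weak derivative against [phi n], a smooth approximation of the
    indicator of ]a, b] whose derivative is an approximate Dirac mass at [a]
    minus one at [b], and letting [n] go to infinity. *)
Lemma weak_deriv_increment f g a b : L1loc f -> L1loc g ->
  loc_abs_cont f -> weak_deriv f g -> 0 < a -> a < b ->
  f b - f a = \int[mu]_(x in `[a, b]) g x.
Proof.
move=> fi gi fac fg a0 ab; have b0 := lt_trans a0 ab.
have [s [Cs s0 s1 s01]] := @smooth_step R.
have [s' ds [s'' ds' _]] := Cs 2.
have cs' : continuous s' by exact: is_derive_continuous ds'.
have s'0 x : ~~ (0 <= x <= 1) -> s' x = 0.
  rewrite negb_and -!ltNge => /orP[x0|x1].
    apply: (@is_derive_near_cst s x 0) (ds x); near=> y; apply: s0.
    by apply: ltW; near: y; exact: lt_nbhsl.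
  apply: (@is_derive_near_cst s x 1) (ds x); near=> y; apply: s1.
  by apply: ltW; near: y; exact: lt_nbhsr.
pose N n : R := n.+1%:R.
have N0 n : 0 < N n by rewrite /N.
have N1 n : (N n)^-1 <= 1 by rewrite invf_le1// /N ler1n.
(* smooth step from 0 to 1 on the interval from [c] to [c + 1 / N n] *)
pose st c n x := s (N n * (x - c)).
pose dst c n x := N n * s' (N n * (x - c)).
have stE c n : st c n = fun x => s (N n * x + N n * - c).
  by apply/funext => x; rewrite /st mulrDr.
have dstP c n x : is_derive x 1 (st c n) (dst c n x).
  exact: is_derive_rescale.
have cdst c n : continuous (dst c n) by exact: continuous_rescale.
have st_eq0 c n x : x <= c -> st c n x = 0.
  by move=> xc; apply: s0; rewrite pmulr_rle0// subr_le0.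
have st_eq1 c n x : c + (N n)^-1 <= x -> st c n x = 1.
  by move=> xc; apply: s1; rewrite -ler_pdivrMl// mulr1 lerBrDl.
have dst_eq0 c n x : ~~ (c <= x <= c + (N n)^-1) -> dst c n x = 0.
  move=> xc; rewrite /dst s'0 ?mulr0//; apply: contra xc => /andP[].
  rewrite pmulr_rge0// subr_ge0 => ->/=.
  by rewrite -ler_pdivlMl// mulr1 lerBlDl.
pose phi n := st a n \- st b n.
have phi_eq0 n x : ~~ (a <= x <= b + 1) -> phi n x = 0.
  rewrite negb_and -!ltNge => /orP[xa|bx].
    by rewrite /phi/= !st_eq0 ?subrr// ltW// (lt_trans xa).
  have bx' c : c <= b -> c + (N n)^-1 <= x.
    by move=> cb; rewrite (le_trans _ (ltW bx))// lerD.
  by rewrite /phi/= !st_eq1 ?subrr//; apply: bx' => //; exact: ltW.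
have phi_test n : test_fun (phi n).
  split; last by exists a, (b + 1); split => // x; exact: phi_eq0.
  apply: nderivable_derivable => m; rewrite /phi !stE.
  have -> : (fun x => s (N n * x + N n * - a)) \-
    (fun x => s (N n * x + N n * - b)) =
    (fun x => s (N n * x + N n * - a)) \+
    ((fun=> -1) \* (fun x => s (N n * x + N n * - b))).
    by apply/funext => x /=; rewrite mulN1r.
  apply: nderivableD; first exact: nderivable_affine.
  by apply: nderivableM; [exact: nderivable_cst|exact: nderivable_affine].
have phi' n : derive1 (phi n) = dst a n \- dst b n.
  apply/funext => x; rewrite derive1E.
  by have [_ ->] := is_deriveB (dstP a n x) (dstP b n x).
have aux c n : 0 < c ->
  mu.-integrable (@Rp R) (EFin \o (fun x => f x * dst c n x)) /\
  \int[mu]_(x in @Rp R) (f x * dst c n x) =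
  \int[mu]_(x in `[c, c + (N n)^-1]) (f x * dst c n x).
  move=> c0.
  have cR : `[c, c + (N n)^-1]%classic `<=` (@Rp R).
    move=> x; rewrite /Rp/= !in_itv/= andbT => /andP[cx _].
    by rewrite ltW// (lt_le_trans c0).
  have z x : ~ `[c, c + (N n)^-1]%classic x -> f x * dst c n x = 0.
    by move=> /= /negP; rewrite in_itv/= => xc; rewrite dst_eq0 ?mulr0.
  split; last by apply: Rintegral_support => // x _; exact: z.
  apply: (@integrable_support _ `[c, c + (N n)^-1]) => // [x _|].
    exact: z.
  apply: integrable_mul_continuous; first by apply: L1loc_sub => //; exact: ltW.
  exact: continuous_subspaceT.
have lim1 c : 0 < c ->
  \int[mu]_(x in @Rp R) (f x * dst c n x) @[n --> \oo] --> f c.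
  move=> c0; under eq_fun do rewrite (aux _ _ c0).2.
  apply: cvg_mollify ds cs' _ _ _ _; [exact: s0|exact: s1| |].
    by apply: L1loc_sub => //; exact: ltW.
  by apply: loc_abs_cont_cvg_right => //; exact: ltW.
(* the weak derivative tested against [phi n] *)
have E1 n : \int[mu]_(x in @Rp R) (f x * dst a n x) -
    \int[mu]_(x in @Rp R) (f x * dst b n x) =
    - \int[mu]_(x in `[a, b + 1]) (g x * phi n x).
  have [ia _] := aux a n a0; have [ib _] := aux b n b0.
  rewrite -RintegralB//; last exact: measurable_itv.
  have := fg _ (phi_test n); rewrite phi'.
  under eq_Rintegral do rewrite mulrBr.
  move=> ->; congr (- _); apply: Rintegral_support.
    move=> x; rewrite /Rp/= !in_itv/= andbT => /andP[cx _].
    by rewrite ltW// (lt_le_trans a0).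
  move=> x _ /= /negP; rewrite in_itv/= => xab.
  by rewrite phi_eq0 ?mulr0//; exact/negP.
have stc c x : st c n x @[n --> \oo] --> ((c < x)%R%:R : R).
  have [cx|xc] := ltP c x; last first.
    by apply: cvg_near_cst; apply: nearW => m; exact: st_eq0.
  apply: cvg_near_cst.
  have xc0 : 0 < x - c by rewrite subr_gt0.
  have := near_infty_natSinv_lt (PosNum xc0); apply: filterS => n /= nx.
  by apply: st_eq1; rewrite -lerBrDl ltW.
have cst_ c n : continuous (st c n) by exact: is_derive_continuous (dstP c n).
have gab : mu.-integrable `[a, b + 1] (EFin \o g).
  by apply: L1loc_sub => //; exact: ltW.
have gphi n : mu.-integrable `[a, b + 1] (EFin \o (fun x => g x * phi n x)).
  apply: integrable_mul_continuous => //.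
  by apply: continuous_subspaceT => x; apply: cvgB; exact: cst_.
have lim2 : \int[mu]_(x in `[a, b + 1]) (g x * phi n x) @[n --> \oo] -->
    \int[mu]_(x in `[a, b]) g x.
  (* [G] is the pointwise limit: [g] on ]a, b], 0 elsewhere *)
  pose G x := g x * ((a < x)%R%:R - (b < x)%R%:R).
  have GE x : a < x <= b -> G x = g x.
    by move=> /andP[ax xb]; rewrite /G ax ltNge xb subr0 mulr1.
  have G0 x : ~~ (a < x <= b) -> G x = 0.
    rewrite negb_and -leNgt -ltNge => /orP[xa|bx].
      by rewrite /G !ltNge xa (le_trans xa (ltW ab)) subrr mulr0.
    by rewrite /G bx (lt_trans ab bx) subrr mulr0.
  have GI : \int[mu]_(x in `[a, b + 1]) G x = \int[mu]_(x in `[a, b]) g x.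
    transitivity (\int[mu]_(x in `]a, b]) g x); last first.
      apply: Rintegral_itv_obnd_cbnd.
      apply: integrableS (L1loc_sub b gi (ltW a0)) => //.
      exact: subset_itv_oc_cc.
    rewrite (@Rintegral_support _ _ `]a, b]%classic).
    - by apply: eq_Rintegral => x; rewrite inE/= in_itv/= => /GE.
    - move=> x /=; rewrite !in_itv/= => /andP[/ltW-> xb]/=.
      by rewrite (le_trans xb)// lerDl.
    - by move=> x _ /= /negP; rewrite in_itv/=; exact: G0.
  have mg : measurable_fun `[a, b + 1] g.
    by apply/measurable_EFinP; exact: measurable_int gab.
  have GL x : (g x * phi n x) @[n --> \oo] --> G x.
    by apply: cvgM; [exact: cvg_cst|apply: cvgB; exact: stc].
  have mG : measurable_fun `[a, b + 1] G.
    have mI c : measurable_fun `[a, b + 1] (fun x => (c < x)%R%:R : R).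
      rewrite (_ : (fun x => _) = \1_(`]c, +oo[)).
        exact: measurable_indic.
      by apply/funext => x; rewrite indicE mem_setE in_itv/= andbT.
    by apply: measurable_funM => //; apply: measurable_funB; exact: mI.
  have gl x : `[a, b + 1]%classic x ->
      (g x * phi n x)%:E @[n --> \oo] --> (G x)%:E.
    by move=> _; apply: cvg_EFin; [exact: nearW|exact: GL].
  have gle x n : `[a, b + 1]%classic x ->
      (`|(g x * phi n x)%:E| <= `|(g x)%:E|)%E.
    move=> _; rewrite lee_fin normrM ler_piMr// /phi/= /st.
    have /andP[u0 u1] := s01 (N n * (x - a)).
    have /andP[v0 v1] := s01 (N n * (x - b)).
    by rewrite ler_norml; lra.
  have [iG _] := @dominated_convergence _ _ _ mu `[a, b + 1] (measurable_itv _)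
    (fun n x => (g x * phi n x)%:E) (fun x => (G x)%:E) (fun x => `|(g x)%:E|%E)
    (fun n => measurable_int mu (gphi n))
    (proj2 (measurable_EFinP _ _) mG) (aeW mu gl)
    (integrable_abse gab) (aeW mu gle).
  rewrite -GI /=.
  under eq_fun do rewrite EFin_Rint//.
  rewrite EFin_Rint//.
  by move/fine_cvgP => [_].
have L : f a - f b = - \int[mu]_(x in `[a, b]) g x.
  rewrite -(cvg_lim (@Rhausdorff R) (cvgB (lim1 a a0) (lim1 b b0))).
  rewrite -(cvg_lim (@Rhausdorff R) (cvgN lim2)).
  by congr (lim (_ @ \oo)); apply/funext => n; exact: E1.
by rewrite -opprB L opprK.
Unshelve. all: by end_near. Qed.
End increments.

Section primitives.
Variable R : realType.
Local Notation mu := (@lebesgue_measure R).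
Implicit Types (f g h phi : R -> R) (a b c x y : R).

Lemma Rintegral_itv_split f a b c : mu.-integrable `[a, c] (EFin \o f) ->
  a <= b -> b <= c ->
  \int[mu]_(x in `[a, c]) f x =
  \int[mu]_(x in `[a, b]) f x + \int[mu]_(x in `[b, c]) f x.
Proof.
move=> fi ab bc.
have fbc : mu.-integrable `]b, c] (EFin \o f).
  apply: integrableS fi => // x /=; rewrite !in_itv/= => /andP[/ltW bx ->].
  by rewrite (le_trans ab bx).
rewrite -(Rintegral_itv_obnd_cbnd fbc).
by rewrite -(@Rintegral_itvB _ f (BLeft a) (BRight c) b)// addrC subrK.
Qed.

(** A locally absolutely continuous function is the primitive of any of its
    weak derivatives: [weak_deriv_increment] extended to the boundary point 0
    by right continuity. *)
Lemma weak_deriv_primitive f g y : L1loc f -> L1loc g ->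
  loc_abs_cont f -> weak_deriv f g -> 0 <= y ->
  f y = f 0 + \int[mu]_(x in `[0, y]) g x.
Proof.
move=> fi gi fac fg; rewrite le_eqVlt => /predU1P[<-|y0].
  by rewrite set_itv1 Rintegral_set1 addr0.
have Ga : \int[mu]_(x in `[0, a]) g x @[a --> 0^'+] --> (0 : R).
  exact/cvg_at_right_filter/(parameterized_integral_cvg_left y0)/(gi y).
have fa := loc_abs_cont_cvg_right fac (lexx 0).
have H : (f a - \int[mu]_(x in `[0, a]) g x) @[a --> 0^'+] --> (f 0 - 0 : R).
  exact: cvgB.
rewrite subr0 in H.
apply/eqP; rewrite -subr_eq; apply/eqP.
rewrite -(cvg_lim (@Rhausdorff R) H); apply/esym/cvg_lim => //.
apply: cvg_near_cst; near=> a.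
have a0 : 0 < a by near: a; exact: nbhs_right_gt.
have ay : a < y by near: a; exact: nbhs_right_lt.
have := weak_deriv_increment fi gi fac fg a0 ay.
have := Rintegral_itv_split (gi y) (ltW a0) (ltW ay).
by move=> -> <- /=; ring.
Unshelve. all: by end_near. Qed.

Lemma primitive_L1loc f g : L1loc g ->
  (forall y, 0 <= y -> f y = f 0 + \int[mu]_(x in `[0, y]) g x) -> L1loc f.
Proof.
move=> gi fE b; have [b0|b0] := leP 0 b; last first.
  by rewrite set_itv_ge ?bnd_simp -?ltNge//; exact: integrable_set0.
apply: (@eq_integrable _ _ _ mu `[0, b] _
  (EFin \o (fun y => f 0 + \int[mu]_(x in `[0, y]) g x))) => //.
  by move=> x; rewrite inE/= in_itv/= => /andP[x0 _]; rewrite -fE.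
apply: continuous_itv_integrable => x.
by apply: cvgD; [exact: cvg_cst|exact: parameterized_integral_continuous].
Qed.

Lemma primitive_weak_deriv f g : L1loc g ->
  (forall y, 0 <= y -> f y = f 0 + \int[mu]_(x in `[0, y]) g x) ->
  weak_deriv f g.
Proof.
move=> gi fE phi [phis [a [b [a0 phi0]]]].
have dphi x : is_derive x 1 phi (derive1 phi x).
  by rewrite derive1E; apply/derivableP; exact: (phis 0%N).
have cphi' : continuous (derive1 phi).
  move=> x; apply/differentiable_continuous/derivable1_diffP; exact: (phis 1%N).
have phi'0 x : ~~ (a <= x <= b) -> derive1 phi x = 0.
  rewrite negb_and -!ltNge => xab.
  apply: (@is_derive_near_cst _ phi x 0) (dphi x).
  case/orP: xab => [xa|bx]; near=> y; apply: phi0; rewrite negb_and -!ltNge.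
    by apply/orP; left; near: y; exact: lt_nbhsl.
  by apply/orP; right; near: y; exact: lt_nbhsr.
(* any nonnegative right end point beyond the support of [phi] will do *)
pose c := Num.max 0 (b + 1).
have c0 : 0 <= c by rewrite le_max lexx.
have bc : b < c by rewrite lt_max [b < b + 1]ltrDl ltr01 orbT.
have cR : `[0, c]%classic `<=` @Rp R.
  by move=> x; rewrite /Rp/= !in_itv/= andbT => /andP[].
have out x : @Rp R x -> ~ `[0, c]%classic x -> ~~ (a <= x <= b).
  rewrite /Rp/= !in_itv/= andbT => -> /negP/=; rewrite -ltNge => cx.
  by rewrite negb_and -!ltNge (lt_trans bc cx) orbT.
rewrite (Rintegral_support cR); last first.
  by move=> x xR /(out _ xR) xab; rewrite phi'0 ?mulr0.
rewrite (@Rintegral_support _ _ _ (fun x => g x * phi x) cR); last first.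
  by move=> x xR /(out _ xR) xab; rewrite phi0 ?mulr0.
have := Rintegral_by_parts (f 0) c0 (gi c) dphi cphi'.
rewrite (phi0 c); last by rewrite negb_and -!ltNge bc orbT.
rewrite (phi0 0); last by rewrite negb_and -!ltNge a0.
rewrite !mulr0 subr0 sub0r => <-; apply: eq_Rintegral => x.
by rewrite inE/= in_itv/= => /andP[x0 _]; rewrite -fE.
Unshelve. all: by end_near. Qed.

(** The weak derivative of a locally absolutely continuous function is unique
    up to null sets. *)
Lemma weak_deriv_unique f g h : L1loc f -> loc_abs_cont f ->
  L1loc g -> weak_deriv f g -> L1loc h -> weak_deriv f h ->
  {ae mu, forall x, 0 <= x -> g x = h x}.
Proof.
move=> fi fac gi fg hi fh.
have ghi b : mu.-integrable `[0, b] (EFin \o (g \- h)).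
  exact: integrableB (gi b) (hi b).
have gh0 b : \int[mu]_(x in `[0, b]) (g x - h x) = 0.
  have [b0|b0] := leP 0 b; last first.
    by rewrite set_itv_ge ?bnd_simp -?ltNge// Rintegral_set0.
  rewrite RintegralB//; apply/eqP; rewrite subr_eq0; apply/eqP.
  apply: (@addrI _ (f 0)).
  by rewrite -!weak_deriv_primitive.
have := ae_eq0_Rintegral ghi gh0; apply: filterS.
  exact: (ae_filter_ringOfSetsType mu).
move=> x gh x0.
by apply/eqP; rewrite -subr_eq0; apply/eqP; exact: gh.
Qed.

Lemma L1loc_measurable f : L1loc f -> measurable_fun (@Rp R) f.
Proof.
move=> fi.
have -> : @Rp R = \bigcup_n `[0, n%:R]%classic.
  apply/seteqP; split => x; rewrite /Rp/= in_itv/= ?andbT.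
    move=> x0; exists (Num.truncn x).+1 => //=; rewrite in_itv/= x0/=.
    by rewrite ltW// Num.Theory.truncnS_gt.
  by case=> n _ /=; rewrite in_itv/= => /andP[].
apply/measurable_fun_bigcup => // n.
by apply/measurable_EFinP; exact: measurable_int (fi n%:R).
Qed.

Lemma wderivP w f : Hw w f -> L1loc (wderiv f) /\ weak_deriv f (wderiv f).
Proof.
move=> [_ _ [g [gi fg _]]].
by apply: (@xgetPex _ _ [set g | L1loc g /\ weak_deriv f g]); exists g.
Qed.

End primitives.

(** * The representing function of the delivery price *)

Section delivery.
Variable R : realType.
Local Notation mu := (@lebesgue_measure R).
Implicit Types (w f g h : R -> R) (a b c d x y s : R).

(** The weight with which the density of the forward curve at [s] enters the
    average over [x, x + d]: the proportion of the delivery period that lies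
    after [s]. *)
Definition delivery_ramp x d s : R :=
  if s <= x then 1 else if s <= x + d then (x + d - s) / d else 0.

Lemma delivery_ramp_itv01 x d s : 0 < d -> 0 <= delivery_ramp x d s <= 1.
Proof.
move=> d0; rewrite /delivery_ramp; have [_|xs] := leP s x.
  by rewrite ler01 lexx.
have [sxd|_] := leP s (x + d); last by rewrite lexx ler01.
by rewrite divr_ge0 ?(ltW d0) ?subr_ge0//= ler_pdivrMr// mul1r; lra.
Qed.

Lemma delivery_ramp_mid x d s : 0 < d -> x <= s <= x + d ->
  delivery_ramp x d s = (x + d - s) / d.
Proof.
move=> d0 /andP[xs sxd]; rewrite /delivery_ramp sxd.
have [sx|//] := leP s x.
have -> : s = x by apply/eqP; rewrite eq_le sx.
by rewrite addrC addKr divff// gt_eqF.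
Qed.

Lemma delivery_ramp_after x d s : 0 < d -> x + d <= s ->
  delivery_ramp x d s = 0.
Proof.
move=> d0; rewrite le_eqVlt => /predU1P[<-|xds].
  by rewrite delivery_ramp_mid ?subrr ?mul0r// lexx lerDl ltW.
by rewrite /delivery_ramp !leNgt xds (lt_trans _ xds)//= ltrDl.
Qed.

Lemma measurable_delivery_ramp x d (D : set R) : 0 < d -> measurable D ->
  measurable_fun D (delivery_ramp x d).
Proof.
move=> d0 mD; apply: nonincreasing_measurable => // s t st.
rewrite /delivery_ramp.
have [tx|xt] := leP t x; first by rewrite (le_trans st tx).
have [sx|xs] := leP s x.
  have /andP[_] := delivery_ramp_itv01 x t d0.
  by rewrite /delivery_ramp (leNgt t) xt.
have [txd|xdt] := leP t (x + d).
  by rewrite (le_trans st txd) ler_pM2r ?invr_gt0// lerD2l lerN2.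
by case: ifP => // sxd; rewrite divr_ge0 ?subr_ge0// ltW.
Qed.

Section kernel.
Variables (w : R -> R) (hw : weight w) (x d : R) (x0 : 0 <= x) (d0 : 0 < d).

(* the density of [delivery_fun] *)
Let k s := delivery_ramp x d s / w s.
Let hd := delivery_fun w x d.

Let w1 s : 0 <= s -> 1 <= w s. Proof. by case: hw => _ + _ _ _; exact. Qed.
Let w0 s : 0 <= s -> 0 < w s.
Proof. by move=> /w1; exact: lt_le_trans. Qed.

Let measurable_invw : measurable_fun (@Rp R) (fun s => (w s)^-1).
Proof.
apply: (@eq_measurable_fun _ _ _ _ _ (fun s => (w (Num.max 0 s))^-1)).
  by move=> s; rewrite inE /Rp/= in_itv/= andbT => s0; rewrite max_r.
apply: nonincreasing_measurable; first exact: measurable_itv.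
move=> s t st; have m0 r : 0 <= Num.max 0 r :> R by rewrite le_max lexx.
rewrite lef_pV2 ?posrE ?w0//; case: hw => _ _ + _ _; apply => //.
by rewrite ge_max m0/= le_max st orbT.
Qed.

Let measurable_k : measurable_fun (@Rp R) k.
Proof.
apply: measurable_funM => //.
by apply: measurable_delivery_ramp => //; exact: measurable_itv.
Qed.

Let k01 s : 0 <= s -> 0 <= k s <= 1.
Proof.
move=> s0; have /andP[r0 r1] := delivery_ramp_itv01 x s d0.
rewrite /k divr_ge0 ?(ltW (w0 s0))//= ler_pdivrMr ?w0// mul1r.
exact: (le_trans r1 (w1 s0)).
Qed.

Let sub_Rp b : `[0, b]%classic `<=` @Rp R.
Proof. by move=> s; rewrite /Rp/= !in_itv/= andbT => /andP[]. Qed.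

Let L1loc_bounded g (M : R) : measurable_fun (@Rp R) g ->
  (forall s, 0 <= s -> `|g s| <= M) -> L1loc g.
Proof.
move=> mg gM b.
have ci : mu.-integrable `[0, b] (EFin \o (fun=> M)).
  by apply: continuous_itv_integrable => y; exact: cvg_cst.
apply: le_integrable ci => //.
  apply/measurable_EFinP; apply: measurable_funS mg => //.
  exact: measurable_itv.
move=> s /=; rewrite in_itv/= => /andP[s0 _].
by rewrite lee_fin (le_trans (gM _ s0))// ler_norm.
Qed.

Let L1loc_k : L1loc k.
Proof.
apply: (@L1loc_bounded _ 1) => // s s0.
have /andP[k0 k1] := k01 s0.
by rewrite ger0_norm.
Qed.

(** The three cases of [delivery_fun] are a single primitive, of the ramp
    divided by the weight. *)
Lemma delivery_fun_primitive y : 0 <= y ->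
  hd y = 1 + \int[mu]_(s in `[0, y]) k s.
Proof.
move=> y0.
have before z : z <= x ->
    \int[mu]_(s in `[0, z]) k s = \int[mu]_(s in `[0, z]) (w s)^-1.
  move=> zx; apply: eq_Rintegral => s; rewrite inE/= in_itv/= => /andP[_ sz].
  by rewrite /k /delivery_ramp (le_trans sz zx) mul1r.
have mid z : x <= z <= x + d ->
    \int[mu]_(s in `[x, z]) k s =
    \int[mu]_(s in `[0, z - x]) ((d - s) / (d * w (s + x))).
  move=> /andP[xz zxd].
  have := @Rintegral_shift _ 0 (z - x) x k.
  rewrite add0r subrK => <-; last exact: L1loc_sub.
  apply: eq_Rintegral => s; rewrite inE/= in_itv/= lerBrDr => /andP[s0 sz].
  rewrite /k delivery_ramp_mid//; last by rewrite lerDr s0 (le_trans sz).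
  by rewrite (_ : _ - _ = d - s) ?invfM ?mulrA//; ring.
rewrite /hd /delivery_fun; case: (leP y x) => [yx|xy].
  by rewrite before.
have xxd : x <= x + d by rewrite lerDl ltW.
case: (leP y (x + d)) => [yxd|xdy].
  rewrite (Rintegral_itv_split (L1loc_k y) x0 (ltW xy)).
  by rewrite before// mid ?addrA// (ltW xy).
rewrite (Rintegral_itv_split (L1loc_k y) x0 (ltW xy)).
rewrite (Rintegral_itv_split (L1loc_sub _ L1loc_k x0) xxd (ltW xdy)).
rewrite before// mid ?xxd ?lexx// (addrC x d) addrK.
rewrite [X in _ = _ + (_ + (_ + X))](_ : _ = 0) ?addr0 ?addrA//.
rewrite (@eq_Rintegral _ _ _ mu _ (fun=> 0)) ?Rintegral_cst ?mul0r// => s.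
rewrite inE/= in_itv/= addrC => /andP[xds _].
by rewrite /k delivery_ramp_after// mul0r.
Qed.

Lemma delivery_fun0 : hd 0 = 1.
Proof.
by rewrite delivery_fun_primitive// set_itv1 Rintegral_set1 addr0.
Qed.

Lemma delivery_fun_weak_deriv : [/\ L1loc k, L1loc hd & weak_deriv hd k].
Proof.
have E y : 0 <= y -> hd y = hd 0 + \int[mu]_(s in `[0, y]) k s.
  by move=> y0; rewrite delivery_fun0; exact: delivery_fun_primitive.
split => //; first exact: primitive_L1loc E.
exact: primitive_weak_deriv E.
Qed.

Lemma delivery_fun_lipschitz a b : 0 <= a -> a <= b ->
  `|hd b - hd a| <= b - a.
Proof.
move=> a0 ab; have b0 := le_trans a0 ab.
rewrite !delivery_fun_primitive// (Rintegral_itv_split (L1loc_k b) a0 ab).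
rewrite (_ : _ - _ = \int[mu]_(s in `[a, b]) k s); last by ring.
have ki : mu.-integrable `[a, b] (EFin \o k) by exact: L1loc_sub.
apply: le_trans; first by apply: le_normr_Rintegral => //; exact: ki.
have -> : b - a = \int[mu]_(s in `[a, b]) 1.
  rewrite (@Rintegral_derive _ a b id (fun=> 1))//.
  by move=> y; exact: cvg_cst.
apply: le_Rintegral => //.
- exact: (@integrable_norm _ _ _ mu _ k).
- by apply: continuous_itv_integrable => y; exact: cvg_cst.
- move=> s /=; rewrite in_itv/= => /andP[as_ _].
  by have /andP[? ?] := k01 (le_trans a0 as_); rewrite ger0_norm.
Qed.

Lemma delivery_fun_Hw : Hw w hd.
Proof.
have [ki hi hk] := delivery_fun_weak_deriv.
split => //.
  move=> L e e0; exists e => // n a b ab _; apply: le_lt_trans.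
  apply: ler_sum => i _; have [a0 abi _] := ab i.
  exact: delivery_fun_lipschitz.
exists k; split => //.
case: (hw) => _ _ _ _; apply: le_lt_trans; apply: ge0_le_integral => //.
- exact: measurable_itv.
- move=> s; rewrite /Rp/= in_itv/= andbT => s0.
  by rewrite lee_fin mulr_ge0 ?sqr_ge0// (ltW (w0 s0)).
- apply/measurable_EFinP; apply: measurable_funM; last by case: hw.
  exact: measurable_funX.
- exact/measurable_EFinP.
- move=> s; rewrite /Rp/= in_itv/= andbT => s0.
  have /andP[r0 r1] := delivery_ramp_itv01 x s d0.
  rewrite lee_fin (_ : k s ^+ 2 * w s = delivery_ramp x d s ^+ 2 / w s).
    by rewrite ler_piMl ?invr_ge0 ?(ltW (w0 s0))// expr_le1.
  by rewrite /k; field; rewrite gt_eqF// w0.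
Qed.

Lemma inner_delivery_fun f : Hw w f ->
  inner w f hd = f 0 + \int[mu]_(s in `[0, x]) wderiv f s
    + \int[mu]_(s in `[x, x + d]) (wderiv f s * ((x + d - s) / d)).
Proof.
move=> hf; have [pi _] := wderivP hf.
have [ki hi hk] := delivery_fun_weak_deriv.
have [qi hq] := wderivP delivery_fun_Hw.
have [_ hac _] := delivery_fun_Hw.
rewrite /inner -/hd delivery_fun0 mulr1 -addrA; congr (_ + _).
set p := wderiv f; set q := wderiv hd.
have mw : measurable_fun (@Rp R) w by case: hw.
have mp : measurable_fun (@Rp R) p by exact: L1loc_measurable.
have mq : measurable_fun (@Rp R) q by exact: L1loc_measurable.
(* [wderiv hd] agrees almost everywhere with the explicit density, and the
   weight cancels *)
transitivity (\int[mu]_(s in @Rp R) (p s * delivery_ramp x d s)).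
  rewrite /Rintegral; congr fine; apply: ae_eq_integral.
  - exact: measurable_itv.
  - apply/measurable_EFinP; apply: measurable_funM => //.
    exact: measurable_funM.
  - apply/measurable_EFinP; apply: measurable_funM => //.
    by apply: measurable_delivery_ramp => //; exact: measurable_itv.
  have := weak_deriv_unique hi hac ki hk qi hq.
  apply: filterS; first exact: (ae_filter_ringOfSetsType mu).
  move=> s kq; rewrite /Rp/= in_itv/= andbT => s0.
  by rewrite /q -kq// /k mulrA divfK// gt_eqF// w0.
have xd0 : 0 <= x + d by rewrite addr_ge0// ltW.
rewrite (@Rintegral_support _ _ _ _ (@sub_Rp (x + d))); last first.
  move=> s; rewrite /Rp/= !in_itv/= andbT => -> /negP/=; rewrite -ltNge => xds.
  by rewrite delivery_ramp_after ?mulr0// ltW.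
have xxd : x <= x + d by rewrite lerDl ltW.
rewrite (Rintegral_itv_split _ x0 xxd); last first.
  apply: (@integrable_mul_bounded _ _ _ _ _ _ _ 1 _ (pi (x + d))) => //.
    by apply: measurable_delivery_ramp => //; exact: measurable_itv.
  move=> s _; have /andP[r0 r1] := delivery_ramp_itv01 x s d0.
  by rewrite ger0_norm.
congr (_ + _); apply: eq_Rintegral => s; rewrite inE/= in_itv/=.
  by move=> /andP[_ sx]; rewrite /delivery_ramp sx mulr1.
by move=> /delivery_ramp_mid->.
Qed.

(** The representation of the average of any element of H_w over the delivery
    period; the forward price is the case of the state at time t. *)
Lemma average_inner f : Hw w f ->
  d^-1 * \int[mu]_(u in `[0, d]) f (x + u) = inner w f hd.
Proof.
move=> hf; rewrite inner_delivery_fun//.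
have [pi fp] := wderivP hf; have [fi fac _] := hf.
have fE y : 0 <= y -> f y = f 0 + \int[mu]_(s in `[0, y]) wderiv f s.
  exact: weak_deriv_primitive.
have xxd : x <= x + d by rewrite lerDl ltW.
have pix b : mu.-integrable `[x, b] (EFin \o wderiv f) by exact: L1loc_sub.
have -> : \int[mu]_(u in `[0, d]) f (x + u) = \int[mu]_(y in `[x, x + d]) f y.
  have := @Rintegral_shift _ 0 d x f.
  rewrite add0r (addrC d) => <-; last exact: L1loc_sub.
  by apply: eq_Rintegral => u _; rewrite addrC.
(* the primitive of 1 / d vanishing at x + d, so that only the boundary term
   at x survives the integration by parts *)
pose phi s := d^-1 * (s - (x + d)).
have dphi s : is_derive s 1 phi d^-1.
  have := is_deriveZ d^-1
    (is_deriveB (is_derive_id s 1) (is_derive_cst (x + d) s 1)).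
  by move=> /is_derive_eq; apply; rewrite /GRing.scale/= subr0 mulr1.
have cphi : continuous (fun _ : R => d^-1 : R) by move=> s; exact: cvg_cst.
have := Rintegral_by_parts (f x) xxd (pix _) dphi cphi.
rewrite (_ : phi (x + d) = 0); last by rewrite /phi subrr mulr0.
rewrite (_ : phi x = - 1); last by rewrite /phi; field; rewrite gt_eqF.
rewrite mulr0 sub0r mulrN1 opprK -fE// => H.
transitivity (\int[mu]_(y in `[x, x + d]) (f y * d^-1)).
  have fix_ : mu.-integrable `[x, x + d] (EFin \o f) by exact: L1loc_sub.
  by rewrite (RintegralZr _ _ fix_)// mulrC.
transitivity (\int[mu]_(y in `[x, x + d])
    ((f x + \int[mu]_(s in `[x, y]) wderiv f s) * d^-1)).
  apply: eq_Rintegral => y; rewrite inE/= in_itv/= => /andP[xy _].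
  congr (_ * _); rewrite (fE x)// fE ?(le_trans x0 xy)//.
  by rewrite (Rintegral_itv_split (pi y) x0 xy) addrA.
rewrite H; congr (_ + _).
rewrite -mulN1r -RintegralZl//; last first.
  apply: integrable_mul_continuous; first exact: pix.
  apply: continuous_subspaceT; exact: is_derive_continuous dphi.
by apply: eq_Rintegral => s _; rewrite /phi; field; rewrite gt_eqF.
Qed.

End kernel.
End delivery.

Unset Implicit Arguments.
Set Strict Implicit.
Set Printing Implicit Defensive.

Theorem corollary2p8 (R : realType)
  (disp : measure_display) (Omega : measurableType disp)
  (P : probability Omega R) (F : R -> set (set Omega)) (hF : filtration F)
  (w : R -> R) (hw : weight w)
  (x0 y0 : R -> R) (hx0 : Hw w x0) (hy0 : Hw w y0)
  (U : R -> (R -> R) -> R -> R) (hU : C0_semigroup w U)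
  (eta : (R -> R) -> R -> R) (heta : bounded_op w eta)
  (QB QW : (R -> R) -> R -> R)
  (hQB : covariance_op w QB) (hQW : covariance_op w QW)
  (B W : R -> Omega -> R -> R)
  (hB : wiener P F w QB B) (hW : wiener P F w QW W)
  (hBW : independent P (Hw_sigma w (@Rp R) B) (Hw_sigma w (@Rp R) W))
  (Z : R -> Omega -> R -> R)
  (hZ : Hw_process w Z) (hZF : adapted F w Z)
  (hZ1 : forall (t : R) (om : Omega), 0 <= t -> Hnorm w (Z t om) = 1)
  (Y : R -> Omega -> R -> R) (hY : Hw_process w Y)
  (hYmild : mild_solution P F w QW W U y0 (fun _ _ => eta) Y)
  (X : R -> Omega -> R -> R) (hX : Hw_process w X)
  (hXmild : mild_solution P F w QB B (@left_shift R) x0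
              (fun s om => tensor w (Z s om) (Y s om)) X)
  (T1 t x d : R) (ht : 0 <= t <= T1) (hx : 0 <= x) (hd : 0 < d) :
  Hw w (delivery_fun w x d) /\
  forall om : Omega,
    delivery_price X t x d om = inner w (X t om) (delivery_fun w x d).
Proof.
split; first exact: delivery_fun_Hw.
move=> om; rewrite /delivery_price /forward_price.
apply: average_inner => //.
by case: hX => XH _; apply: XH; case/andP: ht.
Qed.
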